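(* Let $m \geq 1$ and $n = 4m$. Then $\mathrm{is}'(n) \geq m^2(m-1)(m-2)/6$; that is, in the free monoid $A^*$ there exists an independent system of $m^2(m-1)(m-2)/6$ equations over $n$ unknowns which has a nonperiodic solution.
   Context: $A$ is an alphabet with at least two letters. For a set $\Xi$ of $n$ variables, an equation is a pair $U=V$ with $U,V\in\Xi^*$, and a solution is a morphism $h:\Xi^*\to A^*$ with $h(U)=h(V)$; a solution of a system is a solution of all its equations. Two systems are equivalent if they have the same set of solutions; a system is independent if it is not equivalent to any of its proper subsystems. A solution $h$ is periodic if there is a word $t\in A^*$ such that $h(x)$ is a power of $t$ for every $x\in\Xi$, and nonperiodic otherwise. $\mathrm{is}'(n)$ denotes the maximal size of an independent system over $n$ unknowns in the free monoid that has a nonperiodic solution. *)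

(* Defs.v *)
From mathcomp Require Import all_boot finmap.

Set Implicit Arguments.
Unset Strict Implicit.
Unset Printing Implicit Defensive.

Local Open Scope fset_scope.

Definition equation (X : choiceType) : choiceType := (seq X * seq X)%type.

(* Systems are finite sets of equations.  By the Ehrenfeucht compactness
   property of free monoids every system over finitely many unknowns is
   equivalent to a finite subsystem, so an independent system is finite. *)
Definition system (X : choiceType) := {fset equation X}.

Definition word_morphism (X A : Type) (h : seq X -> seq A) : Prop :=
  h [::] = [::] /\ forall u v, h (u ++ v) = h u ++ h v.

Definition solution (X : choiceType) (A : Type) (S : system X)
    (h : seq X -> seq A) : Prop :=
  word_morphism h /\ forall e, e \in S -> h e.1 = h e.2.

Definition equivalent (X : choiceType) (A : Type) (S T : system X) : Prop :=
  forall h : seq X -> seq A, solution S h <-> solution T h.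

Definition independent (X : choiceType) (A : Type) (S : system X) : Prop :=
  forall T : system X, T `<` S -> ~ equivalent A S T.

Definition wpow (A : Type) (t : seq A) (k : nat) : seq A :=
  flatten (nseq k t).

Definition periodic (X A : Type) (h : seq X -> seq A) : Prop :=
  exists t : seq A, forall x : X, exists k : nat, h [:: x] = wpow t k.

Definition has_nonperiodic_solution (X : choiceType) (A : Type)
    (S : system X) : Prop :=
  exists h : seq X -> seq A, solution S h /\ ~ periodic h.

Definition admissible_size (A : Type) (n k : nat) : Prop :=
  exists S : system 'I_n,
    [/\ independent A S, has_nonperiodic_solution A S & #|` S| = k].

(* [is' A n N] reads "is'(n) = N".  It is a relation rather than a function
   because the finiteness of this maximum is not known a priori. *)
Definition is' (A : Type) (n N : nat) : Prop :=
  admissible_size A n N /\ forall k, admissible_size A n k -> k <= N.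

(* Main.v *)
Require Import Defs.
From mathcomp Require Import all_boot finmap.

Set Implicit Arguments.
Unset Strict Implicit.
Unset Printing Implicit Defensive.

(* The unknowns are x_i, y_i, z_i, t_i for i < m.  For every three-element set
   S = {i < j < k} and every l, take the equation saying that
   x_i x_j x_k y_i y_j y_k z_i z_j z_k commutes with t_l.  Erasing all the t_l
   solves the system.  For independence, fix (l, S) and send x_i, y_i, z_i to
   ab, a, ba for i in S, send t_l to ababa, and erase all other unknowns.  The
   equation of (l, S') says that (ab)^c a^c (ba)^c commutes with ababa, where
   c is the size of the intersection of S and S'; this word is (ababa)^c for
   c <= 2, but the two do not commute for c = 3. *)

Definition subst (X A : Type) (f : X -> seq A) (u : seq X) : seq A :=
  flatten (map f u).

Lemma subst_morphism (X A : Type) (f : X -> seq A) : word_morphism (subst f).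
Proof. by split=> // u v; rewrite /subst map_cat flatten_cat. Qed.

Lemma subst_cat (X A : Type) (f : X -> seq A) (u v : seq X) :
  subst f (u ++ v) = subst f u ++ subst f v.
Proof. exact: (subst_morphism f).2. Qed.

Lemma subst_if (X A : Type) (p : pred X) (w : seq A) (u : seq X) :
  subst (fun x => if p x then w else [::]) u = wpow w (count p u).
Proof.
by rewrite /subst; elim: u => //= x u ->; case: (p x).
Qed.

Lemma wpow_singleton_head (A : Type) (a x0 : A) (t : seq A) (k : nat) :
  wpow t k = [:: a] -> head x0 t = a.
Proof. by case: k => // k; case: t => [|c s] /=; [elim: k | case]. Qed.

(** A common root [t] would have to begin with both [a] and [b]. *)
Lemma nonperiodic_of_letters (X A : Type) (a b : A) (h : seq X -> seq A)
    (x y : X) :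
  a <> b -> h [:: x] = [:: a] -> h [:: y] = [:: b] -> ~ periodic h.
Proof.
move=> ab hx hy [t ht]; apply: ab.
have [k /esym] := ht x; rewrite hx => /(@wpow_singleton_head _ _ a) <-.
have [j /esym] := ht y; rewrite hy => /(@wpow_singleton_head _ _ a) <-.
by [].
Qed.

Section SeparatedFamily.

Variables (X : choiceType) (A : Type) (I : finType) (D : {set I}).
Variables (e : I -> equation X) (h : I -> seq X -> seq A).
Hypothesis h_morph : forall i, word_morphism (h i).
Hypothesis h_sep : forall i j, i \in D -> j \in D ->
  h i (e j).1 = h i (e j).2 <-> i <> j.

(** If [e i = e j] with [i] and [j] distinct, then [h i] would satisfy [e j] but violate [e i]. *)
Lemma separated_card : #|` [fset e i | i in D]%fset| = #|D|.
Proof.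
rewrite card_in_imfset /= ?cardE // => i j iD jD eij.
apply/eqP/negPn/negP => /eqP ij.
have /(h_sep iD jD) := ij; rewrite -eij => /(h_sep iD iD); exact.
Qed.

(** A proper subsystem misses some [e i]; then [h i] solves the subsystem but not the whole
    system. *)
Lemma separated_independent : independent A [fset e i | i in D]%fset.
Proof.
move=> T /andP[/fsubsetP TS /fsubsetPn[x /imfsetP[/= i iD ->] eT]] eqv.
have [|_ /(_ (e i))] := (eqv (h i)).2; last first.
  by rewrite in_imfset //= => /(_ isT) /(h_sep iD iD); exact.
split=> // y yT; have /imfsetP[/= j jD yE] := TS _ yT.
by rewrite yE; apply/(h_sep iD jD) => ij; rewrite ij -yE yT in eT.
Qed.

End SeparatedFamily.

Section Construction.

(* [v (0, i)], [v (1, i)], [v (2, i)], [v (3, i)] are the unknowns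
   x_i, y_i, z_i, t_i. *)
Variables (X : choiceType) (A : Type) (a b : A) (m : nat).
Variables (v : 'I_4 * 'I_m -> X) (d : X -> 'I_4 * 'I_m).
Hypothesis ab : a <> b.
Hypothesis vK : cancel v d.

Definition block (q : 'I_4) (S : {set 'I_m}) : seq X :=
  [seq v (q, i) | i <- enum S].

Definition triple_word (S : {set 'I_m}) : seq X :=
  block (inord 0) S ++ block (inord 1) S ++ block (inord 2) S.

Definition commutation (p : 'I_m * {set 'I_m}) : equation X :=
  (triple_word p.2 ++ [:: v (inord 3, p.1)],
   v (inord 3, p.1) :: triple_word p.2).

Definition triples : {set 'I_m * {set 'I_m}} :=
  [set p : 'I_m * {set 'I_m} | #|p.2| == 3].

Definition witness (p : 'I_m * {set 'I_m}) (x : X) : seq A :=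
  let: (q, i) := d x in
  if val q == 3 then if i == p.1 then [:: a; b; a; b; a] else [::]
  else if i \in p.2 then nth [::] [:: [:: a; b]; [:: a]; [:: b; a]] q
  else [::].

Lemma card_triples : #|triples| = m * 'C(m, 3).
Proof.
have -> : triples = setX [set: 'I_m] [set S : {set 'I_m} | #|S| == 3].
  by apply/setP => p; rewrite !inE.
by rewrite cardsX cardsT card_draws card_ord.
Qed.

Lemma subst_block p (k : nat) (S : {set 'I_m}) : k < 3 ->
  subst (witness p) (block (inord k) S)
    = wpow (nth [::] [:: [:: a; b]; [:: a]; [:: b; a]] k) #|S :&: p.2|.
Proof.
move=> k3; have k4 : k < 4 by exact: ltnW.
(* Only indices in [p.2] contribute a factor, so the exponent is a count along [enum S], as in
   [subst_if]. *)
have -> : #|S :&: p.2| = count (mem p.2) (enum S).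
  rewrite -size_filter cardE; apply/perm_size/uniq_perm.
  - exact: enum_uniq.
  - exact/filter_uniq/enum_uniq.
  by move=> i; rewrite [RHS]mem_filter !mem_enum inE andbC.
rewrite -subst_if /subst /block -map_comp; congr flatten; apply: eq_map => i /=.
by rewrite /witness vK /= inordK // ltn_eqF.
Qed.

Lemma witness_sep p p' : p \in triples -> p' \in triples ->
  subst (witness p) (commutation p').1 = subst (witness p) (commutation p').2
    <-> p <> p'.
Proof.
case: p p' => [l S] [l' S']; rewrite !inE /= => /eqP cS /eqP cS'.
rewrite -(cat1s _ (triple_word _)) !subst_cat !subst_block //=.
have -> : subst (witness (l, S)) [:: v (inord 3, l')]
            = if l' == l then [:: a; b; a; b; a] else [::].
  by rewrite /subst /= cats0 /witness vK /= inordK.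
case: eqP => [->|ll']; last by rewrite cats0; split=> // _ [] /esym.
have [SS'|SS'] := eqVneq S S'.
  (* The two sides first differ at the sixth letter: [b] on the left, [a] on the right. *)
  rewrite -SS' setIid cS; split=> //; rewrite /wpow /= => -[] ba.
  by case: ab.
(* Two distinct triples share at most two indices. *)
have c3 : #|S' :&: S| < 3.
  rewrite -cS'; apply: proper_card; rewrite properEneq subsetIl andbT.
  apply: contra SS' => /eqP/setIidPl sub.
  by rewrite eq_sym eqEcard sub cS cS'.
split=> [_ [] /eqP|_]; first exact/negP.
by case: #|_| c3 => [|[|[|]]].
Qed.

Lemma commutation_nonperiodic : 0 < m ->
  has_nonperiodic_solution A [fset commutation p | p in triples]%fset.
Proof.
move=> m0; pose i0 := Ordinal m0.
(* The default of [nth] erases every [z_i] and [t_i], while [x_i] and [y_i] become distinct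
   letters. *)
pose f x := nth [::] [:: [:: a]; [:: b]] (d x).1.
exists (subst f); split; last first.
  apply: (@nonperiodic_of_letters _ _ a b _ (v (inord 0, i0)) (v (inord 1, i0))).
  - exact: ab.
  - by rewrite /subst /= /f vK /= inordK.
  - by rewrite /subst /= /f vK /= inordK.
split=> [|_ /imfsetP[/= [l S] _ ->]]; first exact: subst_morphism.
rewrite /= -(cat1s _ (triple_word _)) !subst_cat.
have -> : subst f [:: v (inord 3, l)] = [::].
  by rewrite /subst /= /f vK /= inordK.
by rewrite cats0.
Qed.

Lemma admissible_commutation : 0 < m ->
  exists S : system X,
    [/\ independent A S, has_nonperiodic_solution A S
      & #|` S|%fset = m * 'C(m, 3)].
Proof.
move=> m0; exists [fset commutation p | p in triples]%fset.
have morph p := subst_morphism (witness p).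
split.
- exact: (separated_independent morph witness_sep).
- exact: commutation_nonperiodic.
- rewrite -card_triples.
  exact: (separated_card (h := fun p => subst (witness p)) witness_sep).
Qed.

End Construction.

Lemma mul_bin3 (m : nat) : m ^ 2 * (m - 1) * (m - 2) %/ 6 = m * 'C(m, 3).
Proof.
have -> : m ^ 2 * (m - 1) * (m - 2) = m * 'C(m, 3) * 6.
  (* With 6 read as 3 factorial, the right side becomes the falling factorial [m ^_ 3]. *)
  rewrite -[RHS]mulnA -[6]/(3`!) bin_ffact !ffactnS ffactn0 muln1.
  by rewrite -!subn1 -subnDA -mulnn !mulnA.
by rewrite mulnK.
Qed.

(* The division by 6 is exact, and the truncated subtractions are harmless:
   for m = 1 the factor m - 1 already vanishes. *)
Theorem theorem5 (A : Type) (hA : exists a b : A, a <> b)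
    (m n : nat) (hm : 1 <= m) (hn : n = 4 * m) :
  (exists S : system 'I_n,
     [/\ independent A S, has_nonperiodic_solution A S
       & #|` S|%fset = m ^ 2 * (m - 1) * (m - 2) %/ 6])
  /\ (forall N : nat, is' A n N -> m ^ 2 * (m - 1) * (m - 2) %/ 6 <= N).
Proof.
rewrite mul_bin3; have [a [b ab]] := hA.
(* Enumerating the pairs (kind, index) identifies them with the [n] unknowns. *)
have cn : #|{: 'I_4 * 'I_m}| = n by rewrite card_prod !card_ord hn.
have vK : cancel (fun p => cast_ord cn (enum_rank p))
                 (fun x => enum_val (cast_ord (esym cn) x)).
  by move=> p; rewrite cast_ordK enum_rankK.
have admissible := admissible_commutation ab vK hm.
by split=> // N [_]; apply.
Qed.
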